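(* In the quadratic-loss setting described in the context, the multiplicative suboptimality of the shrinkage path heuristic relative to the SAA--RO heuristic satisfies $$\frac{\sup_{\rho\ge0}\big(\hat f_\rho-f_\rho^\star\big)}{\sup_{\rho\ge0}\big(\min\{f_\rho(\boldsymbol x(0)),f_\rho(\boldsymbol x(\infty))\}-f_\rho^\star\big)}\;\le\;\frac{(\kappa-1)^2(\kappa+1)}{(\kappa^{3/2}+1)^2},$$ and the right-hand side is strictly less than one whenever $\kappa\ge1$.
   Context: Setting. The decision $\boldsymbol x$ and the uncertain vector $\boldsymbol\xi$ have the same dimension $k=n$; the support is $\Xi=\mathbb R^n$ and the feasible set is $\mathcal X(\Xi)=\mathbb R^n$. The empirical distribution is $\hat{\mathbb P}=\frac1N\sum_{i=1}^N\delta_{\hat{\boldsymbol\xi}_i}$, $\hat{\boldsymbol\xi}_i\in\mathbb R^n$. The loss is $\ell(\boldsymbol x,\boldsymbol\xi)=L(\boldsymbol\xi^\top\boldsymbol x)$ with $L:\mathbb R\to\mathbb R_+$ convex, Lipschitz and differentiable. $\mathbb B_\rho(\hat{\mathbb P})$ is the set of probability measures on $\mathbb R^n$ whose type-1 Wasserstein distance (with ground metric $\|\boldsymbol\xi-\boldsymbol\xi'\|_2$) to $\hat{\mathbb P}$ is at most $\rho$. Values. $f_\rho(\boldsymbol x)=\sup_{\mathbb Q\in\mathbb B_\rho(\hat{\mathbb P})}\mathbb E_{\mathbb Q}[\ell(\boldsymbol x,\tilde{\boldsymbol\xi})]$; $f^\star_\rho=\min_{\boldsymbol x\in\mathbb R^n}f_\rho(\boldsymbol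 x)$. $\boldsymbol x(0)$ is a fixed minimizer of $f_0(\boldsymbol x)=\frac1N\sum_iL(\hat{\boldsymbol\xi}_i^\top\boldsymbol x)$ over $\mathbb R^n$ (assumed to exist), and $\boldsymbol x(\infty)$ is the robust solution, i.e. a minimizer of $\sup_{\boldsymbol\xi\in\mathbb R^n}L(\boldsymbol\xi^\top\boldsymbol x)$, which in this setting is $\boldsymbol x(\infty)=\boldsymbol0$. The value of the shrinkage path heuristic is $\hat f_\rho=\min_{\lambda\in[0,1]}f_\rho((1-\lambda)\boldsymbol x(0)+\lambda\boldsymbol x(\infty))$. The SAA--RO heuristic selects the better of the two endpoints $\boldsymbol x(0)$ and $\boldsymbol x(\infty)$ at each radius. The multiplicative suboptimality is the ratio of the two worst-case (over $\rho\ge0$) additive suboptimalities; when $\boldsymbol x(0)=\boldsymbol 0$ both vanish and the ratio is interpreted as $0$. Quadratic loss assumptions. With $\mathcal Z:=\{\boldsymbol x^\top\hat{\boldsymbol\xi}_i:\|\boldsymbol x\|_2\le\|\boldsymbol x(0)\|_2,\ i\in[N]\}$, there are $b,c\in\mathbb R$ with $L(z)=z^2+bz+c$ for all $z\in\mathcal Z$. The matrix $\boldsymbol H:=\frac1N\sum_{i=1}^N\hat{\boldsymbol\xi}_i\hat{\boldsymbol\xi}_i^\top$ is positive definite with eigenvalues $0<\lambda_{\min}\le\cdots\le\lambda_{\max}$ and condition number $\kappa:=\lambda_{\max}/\lambda_{\min}$. *)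

(* Defs.v *)
From HB Require Import structures.
From mathcomp Require Import all_boot all_order all_algebra.
From mathcomp Require Import all_classical all_reals all_analysis.

Set Implicit Arguments.
Unset Strict Implicit.
Unset Printing Implicit Defensive.

Import Order.TTheory GRing.Theory Num.Theory.
Import numFieldNormedType.Exports.

Local Open Scope classical_set_scope.
Local Open Scope ring_scope.

Definition dotp (R : realType) (n : nat) (u v : 'cV[R]_n) : R :=
  (u^T *m v) 0 0.

(* The library norm on matrices is the sup norm, hence a separate l2 norm. *)
Definition enorm (R : realType) (n : nat) (u : 'cV[R]_n) : R :=
  Num.sqrt (\sum_(i < n) u i 0 ^+ 2).

(* R^n with its Borel sigma-algebra; the carrier is definitionally 'cV[R]_n. *)
Notation borelRn R n := (g_sigma_algebraType (@open 'cV[R]_n)).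

Definition empirical (R : realType) (n N : nat) (xi : 'I_N -> 'cV[R]_n)
    (A : set (borelRn R n)) : \bar R :=
  ((N%:R^-1)%:E * \sum_(i < N) \d_(xi i : borelRn R n) A)%E.

Definition coupling (R : realType) (n : nat)
    (mu nu : set (borelRn R n) -> \bar R)
    (pi : probability (borelRn R n * borelRn R n)%type R) : Prop :=
  forall A : set (borelRn R n), measurable A ->
    pushforward pi fst A = mu A /\ pushforward pi snd A = nu A.

(* Type-1 Wasserstein distance with ground metric |u - v|_2; it is +oo when
   every coupling has infinite transport cost. *)
Definition wasserstein1 (R : realType) (n : nat)
    (mu nu : set (borelRn R n) -> \bar R) : \bar R :=
  ereal_inf [set (\int[pi]_w (enorm ((w.1 : 'cV[R]_n) - w.2))%:E)%E
            | pi in [set pi | coupling mu nu pi]].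

Definition wball (R : realType) (n N : nat) (xi : 'I_N -> 'cV[R]_n) (rho : R) :
    set (probability (borelRn R n) R) :=
  [set Q | (wasserstein1 Q (empirical xi) <= rho%:E)%E].

Definition wc_loss (R : realType) (n N : nat) (L : R -> R)
    (xi : 'I_N -> 'cV[R]_n) (rho : R) (x : 'cV[R]_n) : \bar R :=
  ereal_sup [set ('E_Q[fun u : borelRn R n => L (dotp u x)])%E
            | Q in wball xi rho].

(* Infima stand for minima here and in shrinkage_value. *)
Definition opt_value (R : realType) (n N : nat) (L : R -> R)
    (xi : 'I_N -> 'cV[R]_n) (rho : R) : \bar R :=
  ereal_inf (range (wc_loss L xi rho)).

Definition saa_loss (R : realType) (n N : nat) (L : R -> R)
    (xi : 'I_N -> 'cV[R]_n) (x : 'cV[R]_n) : R :=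
  N%:R^-1 * \sum_(i < N) L (dotp (xi i) x).

Definition saa_solution (R : realType) (n N : nat) (L : R -> R)
    (xi : 'I_N -> 'cV[R]_n) (x0 : 'cV[R]_n) : Prop :=
  forall x : 'cV[R]_n, saa_loss L xi x0 <= saa_loss L xi x.

Definition robust_loss (R : realType) (n : nat) (L : R -> R) (x : 'cV[R]_n) :
    \bar R :=
  ereal_sup [set (L (dotp u x))%:E | u in [set: 'cV[R]_n]].

(* When L is convex and not constant, 0 is the only robust solution; when L is
   constant every point is one. *)
Definition robust_solution (R : realType) (n : nat) (L : R -> R)
    (xinf : 'cV[R]_n) : Prop :=
  forall x : 'cV[R]_n, (robust_loss L xinf <= robust_loss L x)%E.

Definition shrinkage_value (R : realType) (n N : nat) (L : R -> R)
    (xi : 'I_N -> 'cV[R]_n) (x0 xinf : 'cV[R]_n) (rho : R) : \bar R :=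
  ereal_inf [set wc_loss L xi rho ((1 - t) *: x0 + t *: xinf)
            | t in `[0, 1]].

Definition saa_ro_value (R : realType) (n N : nat) (L : R -> R)
    (xi : 'I_N -> 'cV[R]_n) (x0 xinf : 'cV[R]_n) (rho : R) : \bar R :=
  Order.min (wc_loss L xi rho x0) (wc_loss L xi rho xinf).

Definition additive_subopt (R : realType) (n N : nat) (L : R -> R)
    (xi : 'I_N -> 'cV[R]_n) (v : R -> \bar R) : \bar R :=
  ereal_sup [set (v rho - opt_value L xi rho)%E
            | rho in [set rho : R | 0 <= rho]].

(* The ratio is taken in the extended reals, where a / 0 is +oo for a > 0 and
   0 / 0 is 0; the latter is the convention in force when x0 = 0. *)
Definition multiplicative_subopt (R : realType) (n N : nat) (L : R -> R)
    (xi : 'I_N -> 'cV[R]_n) (x0 xinf : 'cV[R]_n) : \bar R :=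
  (additive_subopt L xi (shrinkage_value L xi x0 xinf) /
   additive_subopt L xi (saa_ro_value L xi x0 xinf))%E.

Definition prediction_set (R : realType) (n N : nat)
    (xi : 'I_N -> 'cV[R]_n) (r : R) : set R :=
  [set z | exists (x : 'cV[R]_n) (i : 'I_N),
             enorm x <= r /\ z = dotp x (xi i)].

Definition second_moment (R : realType) (n N : nat)
    (xi : 'I_N -> 'cV[R]_n) : 'M[R]_n :=
  N%:R^-1 *: \sum_(i < N) (xi i *m (xi i)^T).

Definition posdef (R : realType) (n : nat) (A : 'M[R]_n) : Prop :=
  A^T = A /\ forall x : 'cV[R]_n, x != 0 -> 0 < (x^T *m A *m x) 0 0.

Definition min_eigenvalue (R : realType) (n : nat) (A : 'M[R]_n) (a : R) :
    Prop :=
  eigenvalue A a /\ forall b, eigenvalue A b -> a <= b.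

Definition max_eigenvalue (R : realType) (n : nat) (A : 'M[R]_n) (a : R) :
    Prop :=
  eigenvalue A a /\ forall b, eigenvalue A b -> b <= a.

Definition kappa_bound (R : realType) (k : R) : R :=
  (k - 1) ^+ 2 * (k + 1) / (k `^ (3 / 2) + 1) ^+ 2.

(* Main.v *)
Require Import Defs.
From HB Require Import structures.
From mathcomp Require Import all_boot all_order all_algebra.
From mathcomp Require Import all_classical all_reals all_analysis.
From mathcomp Require Import measurable_realfun complex ring lra.

(* With Lam the best Lipschitz constant of the convex function L, moving a
   vanishing fraction of the empirical mass far away in the direction of x
   shows f_rho(x) = f_0(x) + rho Lam |x|. Near 0 the function f_0 is quadratic:
   f_0(x) = f_0(x0) + B(x - x0) for |x| <= |x0|, where B is the quadratic form of
   H; so, up to the constant f_0(x0), everything reduces to the penalized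
   quadratic B(x - x0) + rho |x|.
   Put h = B(x0), r = |x0| and parametrize the penalty as rho = 2 tau h / r. The
   shrinkage path reaches h (1 - (1 - tau)^2). By duality the optimal value is
   h - d(tau)^2, where d(tau) is the distance (in the dual norm of B) from a
   point to a ball of radius proportional to tau: d is convex, d(0)^2 = h, and
   d(t) = 0 as soon as |H x0| |x0| <= t h. By Kantorovich's inequality this holds for
   t = (kappa + 1) / (2 sqrt kappa). At tau = 1/2 both endpoints have value h, so
   the SAA-RO suboptimality is at least d(1/2)^2, and convexity of d bounds
   d(tau)^2 - h (1 - tau)^2 by (1 - 1 / (2 t - 1)^2) d(1/2)^2 for all tau in [0, 1];
   this factor equals the announced bound. *)

Set Implicit Arguments.
Unset Strict Implicit.
Unset Printing Implicit Defensive.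

Import Order.TTheory GRing.Theory Num.Theory.
Import numFieldNormedType.Exports.

Local Open Scope classical_set_scope.
Local Open Scope ring_scope.

(** * Euclidean geometry and quadratic forms *)

Section Euclidean.
Context {R : realType} {n : nat}.
Implicit Types (u v w x y : 'cV[R]_n) (A : 'M[R]_n) (a : R).

Lemma dotpE u v : dotp u v = \sum_(i < n) u i 0 * v i 0.
Proof. by rewrite /dotp mxE; apply: eq_bigr => i _; rewrite mxE. Qed.

Lemma dotpC u v : dotp u v = dotp v u.
Proof. by rewrite !dotpE; apply: eq_bigr => i _; rewrite mulrC. Qed.

Lemma dotpDr u v w : dotp u (v + w) = dotp u v + dotp u w.
Proof. by rewrite /dotp mulmxDr mxE. Qed.

Lemma dotpZr a u v : dotp u (a *: v) = a * dotp u v.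
Proof. by rewrite /dotp -scalemxAr mxE. Qed.

Lemma dotpNr u v : dotp u (- v) = - dotp u v.
Proof. by rewrite -scaleN1r dotpZr mulN1r. Qed.

Lemma dotpBr u v w : dotp u (v - w) = dotp u v - dotp u w.
Proof. by rewrite dotpDr dotpNr. Qed.

Lemma dotp0r u : dotp u 0 = 0.
Proof. by rewrite -(scale0r u) dotpZr mul0r. Qed.

Lemma dotpDl u v w : dotp (v + w) u = dotp v u + dotp w u.
Proof. by rewrite dotpC dotpDr !(dotpC u). Qed.

Lemma dotpZl a u v : dotp (a *: v) u = a * dotp v u.
Proof. by rewrite dotpC dotpZr (dotpC u). Qed.

Lemma dotpNl u v : dotp (- v) u = - dotp v u.
Proof. by rewrite dotpC dotpNr (dotpC u). Qed.

Lemma dotpBl u v w : dotp (v - w) u = dotp v u - dotp w u.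
Proof. by rewrite dotpDl dotpNl. Qed.

Lemma dotp0l u : dotp 0 u = 0.
Proof. by rewrite dotpC dotp0r. Qed.

Lemma dotp_suml m (F : 'I_m -> 'cV[R]_n) u :
  dotp (\sum_(i < m) F i) u = \sum_(i < m) dotp (F i) u.
Proof.
elim/big_ind2: _ => [|v a w b <- <-|//]; first exact: dotp0l.
exact: dotpDl.
Qed.

Definition dotpLR :=
  (dotpBr, dotpBl, dotpDr, dotpDl, dotpNr, dotpNl, dotpZr, dotpZl).

Lemma dotp_ge0 u : 0 <= dotp u u.
Proof. by rewrite dotpE sumr_ge0// => i _; rewrite -expr2 sqr_ge0. Qed.

Lemma enormE u : enorm u = Num.sqrt (dotp u u).
Proof.
by rewrite /enorm dotpE; congr Num.sqrt; apply: eq_bigr => i _; rewrite expr2.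
Qed.

Lemma enorm_ge0 u : 0 <= enorm u. Proof. exact: sqrtr_ge0. Qed.

Lemma sqr_enorm u : enorm u ^+ 2 = dotp u u.
Proof. by rewrite enormE sqr_sqrtr// dotp_ge0. Qed.

Lemma enorm_eq0 u : enorm u = 0 -> u = 0.
Proof.
move=> u0; have : dotp u u == 0 by rewrite -sqr_enorm u0 expr0n.
rewrite dotpE psumr_eq0 => [/allP ui0|i _]; last by rewrite -expr2 sqr_ge0.
apply/matrixP => i j; rewrite ord1 mxE.
by have := ui0 i (mem_index_enum i); rewrite /= -expr2 sqrf_eq0 => /eqP.
Qed.

Lemma enorm_gt0 u : u != 0 -> 0 < enorm u.
Proof.
by move=> u0; rewrite lt0r enorm_ge0 andbT; apply: contra_neq u0; exact: enorm_eq0.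
Qed.

Lemma enorm0 : enorm (0 : 'cV[R]_n) = 0.
Proof. by rewrite enormE dotp0r sqrtr0. Qed.

Lemma enormZ a u : enorm (a *: u) = `|a| * enorm u.
Proof.
by rewrite !enormE !dotpLR mulrA -expr2 sqrtrM ?sqr_ge0// sqrtr_sqr.
Qed.

Lemma enorm_leP u a : 0 <= a -> (enorm u <= a) = (dotp u u <= a ^+ 2).
Proof.
move=> a0; rewrite -sqr_enorm ler_pXn2r// nnegrE//; exact: enorm_ge0.
Qed.

Lemma cauchy_schwarz u v : dotp u v <= enorm u * enorm v.
Proof.
have [/enorm_eq0 ->|u0] := eqVneq (enorm u) 0; first by rewrite dotp0l enorm0 mul0r.
have [/enorm_eq0 ->|v0] := eqVneq (enorm v) 0; first by rewrite dotp0r enorm0 mulr0.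
have up : 0 < enorm u by rewrite lt0r u0 enorm_ge0.
have vp : 0 < enorm v by rewrite lt0r v0 enorm_ge0.
have := dotp_ge0 (enorm v *: u - enorm u *: v).
rewrite !dotpLR -!sqr_enorm (dotpC v u) => H.
have uv : 0 < enorm u * enorm v by exact: mulr_gt0.
by rewrite -(ler_pM2l uv); nra.
Qed.

Lemma cauchy_schwarz_norm u v : `|dotp u v| <= enorm u * enorm v.
Proof.
rewrite ler_norml cauchy_schwarz andbT lerNl -dotpNl.
by rewrite -[enorm u]mul1r -(@normrN1 R) -enormZ scaleN1r cauchy_schwarz.
Qed.

Lemma enorm_triangle u v : enorm (u + v) <= enorm u + enorm v.
Proof.
rewrite enorm_leP ?addr_ge0 ?enorm_ge0// !dotpLR (dotpC v u).
rewrite sqrrD !sqr_enorm; have := cauchy_schwarz u v; lra.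
Qed.

(* [sqrt (a ^ 2 + e) <= a + e / (2 a)] *)
Lemma enorm_add_le x y : x != 0 ->
  enorm (x + y) <= enorm x + (2 * dotp x y + dotp y y) / (2 * enorm x).
Proof.
move=> x_neq0; have xp := enorm_gt0 x_neq0.
have xe : 0 < 2 * enorm x by rewrite mulr_gt0.
rewrite -(ler_pM2r xe) [leRHS]mulrDl divfK ?gt_eqF//.
have := sqr_enorm (x + y); have := sqr_enorm x.
have := sqr_ge0 (enorm (x + y) - enorm x).
rewrite !dotpLR (dotpC y x); nra.
Qed.

End Euclidean.

(** Near [0] the linear term dominates: at [e = - c / (|k| + 1)] the expression is negative unless
    [c = 0]. *)
Lemma linear_le_quadratic (R : realFieldType) (c k : R) :
  (forall e : R, 0 <= e * c + e ^+ 2 * k) -> c = 0.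
Proof.
move=> ck; apply/eqP; apply: contraT => c0.
have c2 : 0 < c ^+ 2 by rewrite exprn_even_gt0.
pose K := `|k| + 1.
have K0 : 0 < K by rewrite /K ltr_wpDl.
have kK : k < K by rewrite /K ltr_pwDr// ler_norm.
have := ck (- c / K).
have -> : - c / K * c + (- c / K) ^+ 2 * k = - (c ^+ 2 / K * (1 - k / K)).
  by field; rewrite gt_eqF.
rewrite oppr_ge0 leNgt mulr_gt0// ?divr_gt0//.
by rewrite subr_gt0 ltr_pdivrMr// mul1r.
Qed.


(** * Weak duality and stationarity for the penalized quadratic *)

Section PenalizedQuadratic.
Context {R : realType} {n : nat}.
Variable A : 'M[R]_n.
Hypothesis A_posdef : posdef A.
Implicit Types (x y z p : 'cV[R]_n) (a rho : R).

Definition qform x y : R := dotp x (A *m y).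

Lemma qformC x y : qform x y = qform y x.
Proof.
by rewrite /qform dotpC /dotp trmx_mul A_posdef.1 mulmxA.
Qed.

Lemma qform_ge0 x : 0 <= qform x x.
Proof.
have [->|x0] := eqVneq x 0; first by rewrite /qform dotp0l.
by rewrite /qform /dotp mulmxA ltW// A_posdef.2.
Qed.

Lemma qform_gt0 x : x != 0 -> 0 < qform x x.
Proof. by move=> x0; rewrite /qform /dotp mulmxA A_posdef.2. Qed.

Lemma qformDl x y z : qform (x + y) z = qform x z + qform y z.
Proof. exact: dotpDl. Qed.
Lemma qformBl x y z : qform (x - y) z = qform x z - qform y z.
Proof. exact: dotpBl. Qed.
Lemma qformZl a x z : qform (a *: x) z = a * qform x z.
Proof. exact: dotpZl. Qed.
Lemma qformDr x y z : qform z (x + y) = qform z x + qform z y.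
Proof. by rewrite /qform linearD/= dotpDr. Qed.
Lemma qformBr x y z : qform z (x - y) = qform z x - qform z y.
Proof. by rewrite /qform linearB/= dotpBr. Qed.
Lemma qformZr a x z : qform z (a *: x) = a * qform z x.
Proof. by rewrite /qform -scalemxAr dotpZr. Qed.

Lemma qformNN x : qform (- x) (- x) = qform x x.
Proof. by rewrite /qform mulmxN dotpNr dotpNl opprK. Qed.

Definition qformLR := (qformBr, qformBl, qformDr, qformDl, qformZr, qformZl).

(* Weak duality: the dual point of the ball of radius [rho] is [2 A (z - p)]. *)
Lemma penalized_ge z p rho x : enorm (2 *: (A *m (z - p))) <= rho ->
  qform z z - qform p p <= qform (x - z) (x - z) + rho * enorm x.
Proof.
move=> vrho.
have vx : dotp x (2 *: (A *m (z - p))) <= rho * enorm x.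
  rewrite dotpC (le_trans (cauchy_schwarz _ _))//.
  by rewrite ler_wpM2r ?enorm_ge0.
have := qform_ge0 (x - p).
have : dotp x (2 *: (A *m (z - p))) = 2 * (qform x z - qform x p).
  by rewrite dotpZr mulmxBr dotpBr.
rewrite !qformLR (qformC z x) (qformC p x); lra.
Qed.

(** The difference [g] of the two sides is the gradient at [y]. Perturbing [y] along [g] itself,
    with the norm majorized by [enorm_add_le], leaves a quadratic in [e] whose linear coefficient is
    [|g| ^ 2]. *)
Lemma penalized_stationary z rho y : 0 <= rho -> y != 0 ->
    (forall x, qform (y - z) (y - z) + rho * enorm y <=
               qform (x - z) (x - z) + rho * enorm x) ->
  2 *: (A *m (z - y)) = (rho / enorm y) *: y.
Proof.
move=> rho0 y0 ymin; have yp := enorm_gt0 y0.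
apply/esym/eqP; rewrite -subr_eq0; apply/eqP; set g := _ - _.
have gE : g = rho / enorm y *: y - 2 *: (A *m (z - y)) by [].
clearbody g.
suff : dotp g g = 0 by rewrite -sqr_enorm => /eqP; rewrite sqrf_eq0 => /eqP/enorm_eq0.
apply: (@linear_le_quadratic _ _ (qform g g + rho * dotp g g / (2 * enorm y))) => e.
have := ymin (y + e *: g).
have := ler_wpM2l rho0 (enorm_add_le (e *: g) y0).
have : dotp g g = rho / enorm y * dotp y g - 2 * (qform z g - qform y g).
  have <- : dotp (A *m (z - y)) g = qform z g - qform y g.
    by rewrite dotpC mulmxBr dotpBr -!/(qform g _) !(qformC g).
  by rewrite {1}gE dotpBl !dotpZl.
rewrite !dotpLR !qformLR.
have -> : rho * (enorm y + (2 * (e * dotp y g) + e * (e * dotp g g)) / (2 * enorm y))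
  = rho * enorm y + e * (rho / enorm y * dotp y g) + e ^+ 2 * (rho * dotp g g / (2 * enorm y)).
  by field; rewrite gt_eqF.
rewrite (qformC y z) (qformC g z) (qformC g y) => ->; nra.
Qed.

End PenalizedQuadratic.

(** * Kantorovich's inequality *)

Section SpectralBounds.
Context {R : realType} {n : nat}.
Local Notation toC := (real_complex R).
Local Open Scope sesquilinear_scope.

(** The matrix [(A - l) (u - A)] is positive semidefinite: over the complex numbers a unitary matrix
    diagonalizes [A], and the product becomes a sum of terms [(d_i - l) (u - d_i) |y_i| ^ 2]. *)
Lemma spectral_interval (A : 'M[R]_n) (l u : R) (x : 'cV[R]_n) :
    A^T = A -> (forall a, eigenvalue A a -> l <= a <= u) ->
  0 <= dotp (A *m x - l *: x) (u *: x - A *m x).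
Proof.
move=> Asym Alu; set Ac := map_mx toC A; set P := spectralmx Ac.
have real_conj m p (M : 'M[R]_(m, p)) : (map_mx toC M)^T = (map_mx toC M)^t*.
  by apply/matrixP => i j; rewrite !mxE conj_Creal// complex_real.
have Ach : Ac \is hermsymmx.
  apply/is_hermitianmxP; rewrite expr0 scale1r -real_conj.
  by apply/matrixP => i j; rewrite !mxE -[in LHS]Asym mxE.
set d := spectral_diag Ac.
have AE : Ac = P^t* *m diag_mx d *m P.
  rewrite -invmx_unitary ?spectral_unitarymx//.
  exact/orthomx_spectralP/hermitian_normalmx.
have PP : P *m P^t* = 1%:M by exact/unitarymxP/spectral_unitarymx.
have PP' : P^t* *m P = 1%:M by exact/mulmx1C.
(* The diagonal entries are real, and [A] and its complexification share their characteristic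
   polynomial, so these entries are eigenvalues of [A] itself. *)
have dP i : exists2 a, d 0 i = toC a & l <= a <= u.
  have /mxOverP/(_ 0 i)/complex_realP[a da] := hermitian_spectral_diag_real Ach.
  exists a => //; apply: Alu; rewrite eigenvalue_root_char.
  rewrite -(fmorph_root toC) map_char_poly -/Ac -eigenvalue_root_char.
  suff: eigenvalue Ac (d 0 i) by rewrite /d da.
  apply/eigenvalueP; exists (row i P); last first.
    apply: contraTneq isT => /(congr1 (mulmx^~ (P^t*))); rewrite mul0mx -row_mul PP.
    by move=> /matrixP/(_ 0 i); rewrite !mxE eqxx => /eqP; rewrite oner_eq0.
  by rewrite -row_mul AE !mulmxA PP mul1mx; apply/rowP => j; rewrite mul_diag_mx !mxE.
have dotC (v w : 'cV[R]_n) (v' w' : 'cV_n) :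
    map_mx toC v = P^t* *m v' -> map_mx toC w = P^t* *m w' ->
  toC (dotp v w) = \sum_(i < n) (v' i 0)^* * w' i 0.
  move=> vE wE; have -> : toC (dotp v w) = ((map_mx toC v)^T *m map_mx toC w) 0 0.
    by rewrite map_trmx -map_mxM mxE.
  rewrite real_conj vE wE trmx_mul map_mxM trmxCK mulmxA -(mulmxA _ P) PP mulmx1.
  by rewrite mxE; apply: eq_bigr => i _; rewrite !mxE.
set y := P *m map_mx toC x.
have xE : map_mx toC x = P^t* *m y by rewrite /y mulmxA PP' mul1mx.
have AxE : map_mx toC (A *m x) = P^t* *m (diag_mx d *m y).
  by rewrite map_mxM -/Ac AE /y !mulmxA.
rewrite -lecR (@dotC _ _ (diag_mx d *m y - toC l *: y) (toC u *: y - diag_mx d *m y)).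
- rewrite sumr_ge0// => i _; have [a da /andP[la au]] := dP i.
  rewrite mul_diag_mx !mxE da -!mulrBl -!rmorphB [_^*]rmorphM mulrACA.
  rewrite mulr_ge0//; last by rewrite mulrC mul_conjC_ge0.
  apply: mulr_ge0; last by rewrite lecR subr_ge0.
  change (0 <= (toC (a - l))^*); rewrite conj_Creal ?complex_real//.
  by rewrite lecR subr_ge0.
- by rewrite map_mxB map_mxZ AxE xE mulmxBr scalemxAr.
- by rewrite map_mxB map_mxZ AxE xE mulmxBr scalemxAr.
Qed.

(** [spectral_interval] reads [|A x| ^ 2 + l u |x| ^ 2 <= (l + u) <x, A x>]. By AM-GM the left side
    is at least [2 sqrt (l u) |A x| |x|]; dividing by [l] concludes. *)
Lemma kantorovich (A : 'M[R]_n) (l u : R) (x : 'cV[R]_n) :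
    A^T = A -> (forall a, eigenvalue A a -> l <= a <= u) -> 0 < l -> l <= u ->
  2 * Num.sqrt (u / l) * (enorm (A *m x) * enorm x) <= (u / l + 1) * dotp x (A *m x).
Proof.
move=> Asym Alu l0 lu; have := spectral_interval x Asym Alu.
have u0 : 0 < u by exact: lt_le_trans lu.
set s := Num.sqrt (u / l).
have s2 : s ^+ 2 * l = u by rewrite sqr_sqrtr ?divr_ge0 1?ltW// divfK// gt_eqF.
have -> : u / l = s ^+ 2 by rewrite -s2 mulfK// gt_eqF.
rewrite !dotpLR (dotpC (A *m x) x) -!sqr_enorm -s2 => H.
have S := sqr_ge0 (enorm (A *m x) - s * l * enorm x).
rewrite -(ler_pM2l l0); lra.
Qed.
End SpectralBounds.

(** * The penalized quadratic *)

Section Scalar.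
Context {R : realType}.
Implicit Types t tau h D c : R.

Definition gap_ratio t : R := 1 - (2 * t - 1) ^- 2.

Lemma gap_ratioE t : 1 <= t -> gap_ratio t = t * (t - 1) / (t - 2^-1) ^+ 2.
Proof.
move=> t1; rewrite /gap_ratio; field.
by rewrite gt_eqF//; lra.
Qed.

(* [D] is [d (1/2) ^ 2] and [d tau <= (t - tau) / (t - 1/2) * d (1/2)] by
   convexity. *)
Lemma gap_above_half t tau h D : 1 <= t -> 2^-1 <= tau <= 1 -> 0 <= D ->
  D <= h * (1 - (2 * t)^-1) ^+ 2 ->
  ((t - tau) / (t - 2^-1)) ^+ 2 * D <= h * (1 - tau) ^+ 2 + gap_ratio t * D.
Proof.
move=> t1 /andP[tau0 tau1] D0 Dh; rewrite gap_ratioE//.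
have t0 : 0 < t by lra.
have w0 : 0 < t - 2^-1 by lra.
have hD : D * t ^+ 2 <= h * (t - 2^-1) ^+ 2.
  have -> : h * (t - 2^-1) ^+ 2 = h * (1 - (2 * t)^-1) ^+ 2 * t ^+ 2.
    by field; rewrite gt_eqF.
  by rewrite ler_wpM2r// sqr_ge0.
rewrite -(ler_pM2r (exprn_gt0 2 w0)).
have -> : ((t - tau) / (t - 2^-1)) ^+ 2 * D * (t - 2^-1) ^+ 2 = (t - tau) ^+ 2 * D.
  by field; rewrite gt_eqF//; lra.
have -> : (h * (1 - tau) ^+ 2 + t * (t - 1) / (t - 2^-1) ^+ 2 * D) * (t - 2^-1) ^+ 2
   = h * (t - 2^-1) ^+ 2 * (1 - tau) ^+ 2 + t * (t - 1) * D.
  by field; rewrite gt_eqF//; lra.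
(* Once [hD] has bounded [h] from below, what remains is a polynomial multiple of [D], factored
   below. *)
apply: (@le_trans _ _ (D * t ^+ 2 * (1 - tau) ^+ 2 + t * (t - 1) * D)); last first.
  by rewrite lerD2r ler_wpM2r// sqr_ge0.
rewrite -subr_ge0.
have -> : D * t ^+ 2 * (1 - tau) ^+ 2 + t * (t - 1) * D - (t - tau) ^+ 2 * D =
  D * ((t - 1) * (t * (1 - tau) ^+ 2 + tau ^+ 2)) by ring.
apply: mulr_ge0 => //; apply: mulr_ge0; first by rewrite subr_ge0.
by rewrite addr_ge0 ?sqr_ge0// pmulr_rge0// sqr_ge0.
Qed.

(* The left side is the form at [(1 - 2 tau) x0 + 2 tau y], with [c = B x0 y]
   and [D = B y y]. *)
Lemma gap_below_half t tau h D c : 1 <= t -> 0 <= tau <= 2^-1 -> 0 <= h ->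
  h / 4 <= D -> D <= h * (1 - (2 * t)^-1) ^+ 2 -> c ^+ 2 <= h * D ->
  (1 - 2 * tau) ^+ 2 * h + 4 * tau * (1 - 2 * tau) * c + 4 * tau ^+ 2 * D
    <= h * (1 - tau) ^+ 2 + gap_ratio t * D.
Proof.
move=> t1 /andP[tau0 tau1] h0 hD Dh cD.
have t0 : 0 < t by lra.
have D0 : 0 <= D by lra.
have [f [f0 hE]] : exists f, 0 <= f /\ h = f ^+ 2.
  by exists (Num.sqrt h); rewrite sqrtr_ge0 sqr_sqrtr.
have [e [e0 DE]] : exists f, 0 <= f /\ D = f ^+ 2.
  by exists (Num.sqrt D); rewrite sqrtr_ge0 sqr_sqrtr.
have q0 : 0 <= 1 - (2 * t)^-1 by rewrite subr_ge0 invf_le1 ?mulr_gt0//; lra.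
move: hD Dh cD; rewrite {}hE {}DE -!exprMn => hD Dh cD.
have {hD} fe : f <= 2 * e by rewrite -(@ler_pXn2r _ 2) ?nnegrE ?mulr_ge0//; lra.
have {Dh} ef : e <= f * (1 - (2 * t)^-1).
  by rewrite -(@ler_pXn2r _ 2) ?nnegrE ?mulr_ge0.
have {cD} cef : c <= f * e.
  rewrite (le_trans (ler_norm _))// -(@ler_pXn2r _ 2) ?nnegrE ?mulr_ge0//.
  by rewrite real_normK ?num_real.
(* This removes [t]: [gap_ratio t * D] is at least [e ^ 2 - f ^ 2 / 4]. *)
have et : (e * (2 * t - 1)^-1) ^+ 2 <= (f / 2) ^+ 2.
  have w0 : 0 < 2 * t - 1 by lra.
  rewrite ler_pXn2r ?nnegrE ?mulr_ge0 ?invr_ge0 ?(ltW w0)//.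
  rewrite ler_pdivrMr//.
  have -> : f / 2 * (2 * t - 1) = f * (1 - (2 * t)^-1) * t.
    by field; rewrite gt_eqF.
  by nra.
have TE : gap_ratio t * e ^+ 2 = e ^+ 2 - (e * (2 * t - 1)^-1) ^+ 2.
  by rewrite /gap_ratio exprMn exprVn; ring.
have c1 : 4 * tau * (1 - 2 * tau) * c <= 4 * tau * (1 - 2 * tau) * (f * e).
  by rewrite ler_wpM2l// !mulr_ge0//; lra.
(* With [c] replaced by [f e] and [gap_ratio t * D] by [e ^ 2 - f ^ 2 / 4], the difference of the
   two sides is this product. Its last factor is nonnegative because [3 f - 2 e] lies between [0]
   and [2 f], and [tau <= 1/2]. *)
have : 0 <= (2 * e - f) * ((2^-1 - tau) * (2 * f - (3 * f - 2 * e) * (2^-1 + tau))).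
  by rewrite mulr_ge0 ?mulr_ge0//; nra.
rewrite TE; lra.
Qed.

End Scalar.

(** * Existence of a minimizer and the gap of the shrinkage path *)

Section Minimizer.
Context {R : realType} {n : nat}.

Lemma continuous_dotp (T : topologicalType) (F G : T -> 'cV[R]_n) :
  (forall i, continuous (fun u => F u i 0)) ->
  (forall i, continuous (fun u => G u i 0)) ->
  continuous (fun u => dotp (F u) (G u)).
Proof.
move=> cF cG.
rewrite (_ : (fun u => _) = (fun u => \sum_(i < n) F u i 0 * G u i 0)); last first.
  by apply/funext => u; rewrite dotpE.
apply: continuous_big => [|i _ u]; last exact: continuousM (cF i u) (cG i u).
exact: add_continuous.
Qed.

(** A continuous function attains its minimum on a compact box, and outside the box of half-width
    [r] the penalty alone exceeds the value [rho r] at [0]. *)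
Lemma penalized_minimizer (A : 'M[R]_n) (z : 'cV[R]_n) (rho : R) : posdef A -> 0 < rho ->
  exists y : 'cV[R]_n, forall x,
    qform A (y - z) (y - z) + rho * enorm y <= qform A (x - z) (x - z) + rho * enorm x.
Proof.
move=> Apos rho0.
pose r := qform A z z / rho.
have r0 : 0 <= r by rewrite divr_ge0 ?(qform_ge0 Apos)// ltW.
pose F (x : 'cV[R]_n) := qform A (x - z) (x - z) + rho * enorm x.
pose box := [set v : 'rV[R]_n | forall i, `[- r, r]%classic (v ord0 i)].
have box0 : box 0 by move=> i /=; rewrite mxE in_itv/= oppr_le0 r0.
have cbox : compact box.
  by apply: (@rV_compact _ _ (fun=> `[(- r), r]%classic)) => i; exact: segment_compact.
have cF : {within box, continuous (fun u => F u^T)}.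
  apply: continuous_subspaceT; rewrite /F /qform.
  have ctr i : continuous (fun u : 'rV[R]_n => u^T i 0).
    rewrite (_ : (fun u => _) = (fun u : 'rV[R]_n => u 0 i)).
      exact: coord_continuous.
    by apply/funext => u; rewrite mxE.
  have csub i : continuous (fun u : 'rV[R]_n => (u^T - z) i 0).
    rewrite (_ : (fun u => _) = (fun u : 'rV[R]_n => u^T i 0 - z i 0)).
      by move=> u; apply: continuousB; [exact: ctr|exact: cst_continuous].
    by apply/funext => u; rewrite !mxE.
  move=> u; apply: (@continuousD _ _ _
    (fun u : 'rV[R]_n => dotp (u^T - z) (A *m (u^T - z)))
    (fun u => rho * enorm u^T)).
    apply: continuous_dotp u => // i.
    rewrite (_ : (fun u => _) = (fun u => dotp (row i A)^T (u^T - z))); last first.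
      by apply/funext => u; rewrite /dotp trmxK -row_mul [RHS]mxE.
    by apply: continuous_dotp => // j; exact: cst_continuous.
  apply: continuousM; first exact: cst_continuous.
  rewrite (_ : (fun u => enorm _) = (fun u => Num.sqrt (dotp u^T u^T))); last first.
    by apply/funext => v; rewrite enormE.
  apply: (@continuous_comp _ _ _ (fun v : 'rV[R]_n => dotp v^T v^T) Num.sqrt).
    exact: continuous_dotp.
  exact: sqrt_continuous.
have [c cb cmin] := EVT_min_rV (ex_intro _ _ box0) cbox cF.
exists c^T => x; rewrite -!/(F _).
have [xbox|xbox] := pselect (box x^T).
  by have := cmin x^T; rewrite inE trmxK; exact.
have := cmin 0; rewrite inE trmx0 => /(_ box0) /le_trans; apply.
rewrite /F add0r enorm0 mulr0 addr0.
have -> : qform A (- z) (- z) = rho * r.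
  by rewrite qformNN /r mulrC divfK ?gt_eqF.
have [i xi] : exists i, r < `|x i 0|.
  apply: contrapT => /forallNP H; apply: xbox => i /=.
  by rewrite mxE in_itv/= -ler_norml leNgt; apply/negP/H.
rewrite -[leLHS]add0r lerD ?(qform_ge0 Apos)// ler_wpM2l ?(ltW rho0)//.
rewrite (le_trans (ltW xi))// -(@ler_pXn2r _ 2) ?nnegrE ?enorm_ge0//.
rewrite sqr_enorm dotpE (bigD1 i)//= real_normK ?num_real// expr2 lerDl.
by rewrite sumr_ge0// => j _; rewrite -expr2 sqr_ge0.
Qed.


(** Cauchy-Schwarz for the form, from its positivity at [B(y, y) x - B(x, y) y]. *)
Lemma sqr_qform_le (A : 'M[R]_n) (x y : 'cV[R]_n) : posdef A ->
  qform A x y ^+ 2 <= qform A x x * qform A y y.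
Proof.
move=> Apos; have [->|y0] := eqVneq y 0.
  by rewrite -(scale0r y) !qformLR !mul0r expr0n mulr0.
have yp := qform_gt0 Apos y0.
have := qform_ge0 Apos (qform A y y *: x - qform A x y *: y).
rewrite !qformLR (qformC Apos y x) => H.
by rewrite -subr_ge0 -(pmulr_rge0 _ yp); lra.
Qed.

(** The witness [y] minimizes [pen (h / r)], the case [tau = 1/2], so [h - pen (h / r) y] is
    [d (1/2) ^ 2]. It will bound the SAA-RO suboptimality from below, while the last clause bounds
    that of the path, [s] being the shrinkage parameter. *)
Lemma shrinkage_gap (A : 'M[R]_n) (z : 'cV[R]_n) (t : R)
    (pen := fun rho x => qform A (x - z) (x - z) + rho * enorm x)
    (h := qform A z z) (r := enorm z) :
    posdef A -> z != 0 -> 1 <= t -> enorm (A *m z) * r <= t * h ->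
  exists y : 'cV[R]_n, [/\ enorm y <= r, pen (h / r) y < h
    & forall rho x, 0 <= rho -> exists2 s, 0 <= s <= 1 &
      pen rho ((1 - s) *: z) - pen rho x <= gap_ratio t * (h - pen (h / r) y)].
Proof.
move=> Apos z0 t1 tH.
have h0 : 0 < h by exact: qform_gt0.
have r0 : 0 < r by exact: enorm_gt0.
have t0 : 0 < t by lra.
have [y ymin] := penalized_minimizer z Apos (divr_gt0 h0 r0).
have penz s rho : s <= 1 -> pen rho ((1 - s) *: z) = s ^+ 2 * h + rho * ((1 - s) * r).
  move=> s1; rewrite /pen (_ : _ - z = (- s) *: z); last first.
    by rewrite scalerBl scale1r addrC addKr scaleNr.
  by rewrite enormZ ger0_norm ?subr_ge0// !qformLR -/h -/r; ring.
(* Comparison with [z / 2], of value [h / 4 + h / 2]. Since [0] has value [h], it cannot be [y]. *)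
have yhalf : pen (h / r) y <= 3 / 4 * h.
  have := ymin ((1 - 2^-1) *: z); rewrite -/(pen _ _) -/(pen _ _) penz; last lra.
  move=> /le_trans; apply; rewrite le_eqVlt; apply/orP; left; apply/eqP.
  by field; rewrite gt_eqF.
have y0 : y != 0.
  apply: contraTneq yhalf => ->; rewrite /pen add0r enorm0 mulr0 addr0 -ltNge.
  by rewrite qformNN -/h; lra.
have stat := penalized_stationary Apos (ltW (divr_gt0 h0 r0)) y0 ymin.
have yp := enorm_gt0 y0.
have nstat : enorm (2 *: (A *m (z - y))) = h / r.
  rewrite stat enormZ ger0_norm ?divr_ge0 ?ltW//.
  by field; rewrite !gt_eqF.
set D := qform A y y.
(* Pairing the stationarity equation with [y] eliminates the norm. *)
have penyE : pen (h / r) y = h - D.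
  have : dotp y (2 *: (A *m (z - y))) = h / r * enorm y.
    by rewrite stat dotpZr -sqr_enorm; field; rewrite !gt_eqF.
  rewrite dotpZr mulmxBr dotpBr -!/(qform A _ _) /pen => <-.
  by rewrite !qformLR (qformC Apos z y) /D /h; ring.
have hD : h / 4 <= D by move: yhalf; rewrite penyE; lra.
have nAz : enorm (A *m z) <= t * h / r by rewrite ler_pdivlMr.
(* Weak duality at [p = (1 - 1 / (2 t)) z], which is feasible by the hypothesis [|A z| r <= t h]. *)
have Dh : D <= h * (1 - (2 * t)^-1) ^+ 2.
  have zE : z - (1 - (2 * t)^-1) *: z = (2 * t)^-1 *: z.
    by rewrite scalerBl scale1r opprB addrC subrK.
  have vle : enorm (2 *: (A *m (z - (1 - (2 * t)^-1) *: z))) <= h / r.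
    rewrite zE -scalemxAr !enormZ !ger0_norm ?invr_ge0 ?mulr_ge0 ?(ltW t0)//.
    have -> : 2 * ((2 * t)^-1 * enorm (A *m z)) = enorm (A *m z) / t.
      by field; rewrite gt_eqF.
    by rewrite ler_pdivrMr// (le_trans nAz)// [leRHS]mulrC mulrA.
  have := penalized_ge Apos y vle.
  by rewrite -/(pen _ _) penyE !qformLR -/h; lra.
exists y; split.
(* The value at [z] is [h], so [(h / r) |y| <= h]. *)
- have := ymin z; rewrite -/(pen _ _) -/(pen _ _).
  rewrite {2}/pen subrr /qform dotp0l add0r -/r divfK ?gt_eqF//.
  have := qform_ge0 Apos (y - z); rewrite /pen => q0 q1.
  have : h / r * enorm y <= h / r * r by rewrite divfK ?gt_eqF//; lra.
  by rewrite ler_pM2l ?divr_gt0.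
- by rewrite penyE; lra.
rewrite penyE subKr => rho x rho0.
(* The left side is the value reached by the path minus the allowed gap. Each half of the range of
   [tau] has its own dual point for [penalized_ge]. *)
have claim tau : 0 <= tau <= 1 ->
    h - h * (1 - tau) ^+ 2 - gap_ratio t * D <= pen (2 * tau * (h / r)) x.
  move=> /andP[tau0 tau1]; have [tauh|tauh] := leP tau 2^-1.
    (* This goes from [z] at [tau = 0] to [y] at [tau = 1/2], and the norm of the dual vector is
       proportional to [tau]. *)
    pose p := (1 - 2 * tau) *: z + (2 * tau) *: y.
    have pE : z - p = (2 * tau) *: (z - y) by apply/matrixP => i j; rewrite !mxE; ring.
    have vle : enorm (2 *: (A *m (z - p))) <= 2 * tau * (h / r).
      rewrite pE -scalemxAr scalerA mulrC -scalerA enormZ nstat ger0_norm//.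
      by rewrite mulr_ge0.
    apply: le_trans (penalized_ge Apos x vle); rewrite /p.
    have tt : 0 <= tau <= 2^-1 by rewrite tau0.
    have := gap_below_half t1 tt (ltW h0) hD Dh (sqr_qform_le z y Apos).
    by rewrite !qformLR (qformC Apos y z) -/h -/D; lra.
  (* The point [mu y] goes from [y] at [tau = 1/2] to [0] at [tau = t], where [0] is feasible by the
     hypothesis on [|A z|]. *)
  pose mu := (t - tau) / (t - 2^-1).
  have w0 : 0 < t - 2^-1 by lra.
  have mu0 : 0 <= mu by rewrite divr_ge0//; lra.
  have mu1 : mu <= 1 by rewrite ler_pdivrMr//; lra.
  have pE : z - mu *: y = mu *: (z - y) + (1 - mu) *: z.
    by apply/matrixP => i j; rewrite !mxE; ring.
  have vle : enorm (2 *: (A *m (z - mu *: y))) <= 2 * tau * (h / r).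
    rewrite pE mulmxDr -!scalemxAr scalerDr scalerA mulrC -scalerA.
    rewrite (le_trans (enorm_triangle _ _))// enormZ nstat !enormZ.
    rewrite !ger0_norm ?subr_ge0//.
    have : (1 - mu) * enorm (A *m z) <= (1 - mu) * (t * h / r).
      by rewrite ler_wpM2l ?subr_ge0.
    have : mu * (h / r) + 2 * ((1 - mu) * (t * h / r)) = 2 * tau * (h / r).
      by rewrite /mu; field; rewrite !gt_eqF//; lra.
    lra.
  apply: le_trans (penalized_ge Apos x vle).
  have tt : 2^-1 <= tau <= 1 by rewrite tau1 ltW.
  have := gap_above_half t1 tt (qform_ge0 Apos y) Dh.
  by rewrite -/mu !qformLR -/h -/D; lra.
(* Up to [2 h / r] the best shrinkage is [s = tau]. Beyond, the fully shrunk point [0] has value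
   [h], and the bound at [tau = 1] persists by monotonicity in [rho]. *)
have [rho_le|rho_gt] := leP rho (2 * (h / r)).
  pose tau := rho / (2 * (h / r)).
  have hr : 0 < 2 * (h / r) by rewrite mulr_gt0 ?divr_gt0.
  have tau01 : 0 <= tau <= 1 by rewrite /tau ler_pdivrMr// mul1r rho_le divr_ge0// ltW.
  have rhoE : rho = 2 * tau * (h / r) by rewrite /tau; field; rewrite !gt_eqF.
  exists tau => //; rewrite penz; last by case/andP: tau01.
  have := claim _ tau01; rewrite -rhoE.
  have : rho * ((1 - tau) * r) = 2 * tau * (1 - tau) * h.
    by rewrite {1}rhoE; field; rewrite gt_eqF.
  by move=> ->; lra.
exists 1; first by rewrite ler01 lexx.
rewrite penz// subrr mul0r mulr0 addr0 expr1n mul1r.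
have := claim 1; rewrite ler01 lexx => /(_ isT); rewrite subrr expr0n/= mulr0 mulr1 /pen.
have : 2 * (h / r) * enorm x <= rho * enorm x by rewrite ler_wpM2r ?enorm_ge0// ltW.
lra.
Qed.

End Minimizer.

(** * The announced bound as a function of the condition number *)

Section Kappa.
Context {R : realType}.

(** With [s = sqrt k], [2 t - 1 = (s ^ 2 - s + 1) / s] and [s ^ 3 + 1 = (s + 1) (s ^ 2 - s + 1)], so
    [(s + 1) ^ 2] cancels from [kappa_bound k]. *)
Lemma kappa_bound_gap (k : R) : 1 <= k ->
  kappa_bound k = gap_ratio ((k + 1) / (2 * Num.sqrt k)).
Proof.
move=> k1; have k0 : 0 < k by lra.
pose s := Num.sqrt k; have kE : k = s ^+ 2 by rewrite sqr_sqrtr ?ltW.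
have s0 : 0 < s by rewrite sqrtr_gt0.
have k32 : k `^ (3 / 2) = s ^+ 3.
  rewrite (_ : 3 / 2 = 1 + 2^-1 :> R); last by field.
  rewrite powRD; last by rewrite gt_eqF ?implybT.
  by rewrite powRr1 ?powR12_sqrt ?ltW// -/s {1}kE -exprSr.
rewrite /kappa_bound /gap_ratio k32 -/s kE.
have p0 : 0 < s ^+ 2 - s + 1 by have := sqr_ge0 (s - 2^-1); rewrite sqrrB; nra.
have p1 : 0 < s ^+ 3 + 1 by rewrite addr_gt0 ?exprn_gt0.
field; rewrite ?gt_eqF//; lra.
Qed.

Lemma gap_ratio_lt1 (t : R) : 1 <= t -> gap_ratio t < 1.
Proof.
by move=> t1; rewrite ltrBlDr ltrDl invr_gt0 exprn_gt0//; lra.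
Qed.

Lemma gap_ratio_ge0 (t : R) : 1 <= t -> 0 <= gap_ratio t.
Proof.
move=> t1; rewrite gap_ratioE// divr_ge0 ?sqr_ge0// mulr_ge0//; lra.
Qed.

Lemma kappa_mean_ge1 (k : R) : 1 <= k -> 1 <= (k + 1) / (2 * Num.sqrt k).
Proof.
move=> k1; have k0 : 0 < k by lra.
rewrite ler_pdivlMr ?mulr_gt0 ?sqrtr_gt0//.
have := sqr_ge0 (Num.sqrt k - 1); rewrite sqrrB sqr_sqrtr; lra.
Qed.

End Kappa.

(** * Worst-case losses over Wasserstein balls *)

Section Discrete.
Context {R : realType}.
Local Open Scope ereal_scope.

(** This supplies the empirical distribution, its perturbations, and the couplings that certify
    their transport cost. *)
Lemma discrete_probability d (T : measurableType d) (I : finType)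
    (w : I -> {nonneg R}) (p : I -> T) :
    (\sum_(i : I) (w i)%:num = 1)%R ->
  exists P : probability T R,
    (forall A, P A = \sum_(i : I) (w i)%:num%:E * \d_(p i) A) /\
    (forall f : T -> \bar R, (forall x, 0 <= f x) -> measurable_fun setT f ->
      \int[P]_x f x = \sum_(i : I) (w i)%:num%:E * f (p i)).
Proof.
move=> w1.
(* [msum] is indexed by naturals, hence the enumeration of [I], padded with the null measure. *)
pose m k : {measure set T -> \bar R} :=
  if (insub k : option 'I_#|I|) is Some j
  then mscale (w (enum_val j)) \d_(p (enum_val j)) else mzero.
have mE (j : 'I_#|I|) : m j = mscale (w (enum_val j)) \d_(p (enum_val j)).
  by rewrite /m insubT//= => lj; congr mscale; rewrite (_ : Sub _ _ = j)//; exact: val_inj.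
have sumE (F : I -> \bar R) : \sum_(i : I) F i = \sum_(j < #|I|) F (enum_val j).
  exact: reindex (onW_bij _ (@enum_val_bij _)).
have PE A : msum m #|I| A = \sum_(i : I) (w i)%:num%:E * \d_(p i) A.
  by rewrite sumE; apply: eq_bigr => j _; rewrite mE.
have P1 : msum m #|I| setT = 1.
  rewrite PE (eq_bigr (fun i => (w i)%:num%:E)) ?sumEFin ?w1// => i _.
  by rewrite diracT mule1.
pose P : probability T R := HB.pack (msum m #|I|)
  (Measure_isProbability.Build _ _ _ (msum m #|I|) P1).
exists P; split=> [A|f f0 mf]; first exact: PE.
rewrite (ge0_integral_measure_sum m measurableT)// sumE.
apply: eq_bigr => j _; rewrite mE ge0_integral_mscale// integral_dirac//.
by rewrite diracT mul1e.
Qed.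

End Discrete.

(** * Measurability on [R^n] *)

Section BorelMeasurability.
Context {R : realType} {n : nat}.
Local Notation T := (borelRn R n).

Lemma continuous_borel_measurable (f : 'cV[R]_n -> R) : continuous f ->
  measurable_fun [set: T] (f : T -> R).
Proof.
move=> /continuousP cf; apply: (measurability _ (RGenOpens.measurableE R)).
move=> _ [_ [a [b ->] <-]]; rewrite setTI; apply: sub_sigma_algebra.
exact/cf/interval_open.
Qed.

Lemma measurable_coord (i : 'I_n) :
  measurable_fun [set: T] (fun u : T => (u : 'cV[R]_n) i 0).
Proof. by apply: continuous_borel_measurable; exact: coord_continuous. Qed.

Lemma measurable_dotp (x : 'cV[R]_n) : measurable_fun [set: T] (fun u : T => dotp u x).
Proof.
apply: continuous_borel_measurable; apply: continuous_dotp => i.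
  exact: coord_continuous.
exact: cst_continuous.
Qed.

(** The sigma-algebra on pairs is the product one, so the argument goes through coordinates rather
    than continuity on the product. *)
Lemma measurable_enormB :
  measurable_fun [set: T * T] (fun w : T * T => enorm ((w.1 : 'cV[R]_n) - w.2)).
Proof.
rewrite /enorm; apply: measurableT_comp.
  by apply: continuous_measurable_fun; exact: sqrt_continuous.
apply: measurable_sum => i; apply: measurable_funX.
rewrite (_ : (fun w : T * T => _) =
  (fun w : T * T => (w.1 : 'cV[R]_n) i 0 - (w.2 : 'cV[R]_n) i 0)).
  by apply: measurable_funB; apply: (measurableT_comp (measurable_coord i)).
by apply/funext => w; rewrite !mxE.
Qed.

End BorelMeasurability.

(** * Secants and the best Lipschitz constant of a convex function *)

Section ConvexSlopes.
Context {R : realType}.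
Variable L : R -> R.
Hypothesis L_ge0 : forall z : R, 0 <= L z.
Hypothesis L_convex : @convex_function R R^o setT L.
Hypothesis L_lipschitz : lipschitz (L : R^o -> R^o).

Lemma convex_le (t a b : R) : 0 <= t <= 1 ->
  L (t * a + (1 - t) * b) <= t * L a + (1 - t) * L b.
Proof.
move=> /andP[t0 t1]; have := L_convex (Itv01 t0 t1) (in_setT (a : R^o)) (in_setT b).
by rewrite !convRE/=.
Qed.

(** On the left, [a] is a convex combination of [z] and [b]; on the right, [b] is one of [a] and
    [z]. *)
Lemma chord_le (a b z : R) : a < b -> z <= a \/ b <= z ->
  L a + (L b - L a) / (b - a) * (z - a) <= L z.
Proof.
move=> ab; have ba : 0 < b - a by rewrite subr_gt0.
case=> [za|bz].
  have bz : 0 < b - z by lra.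
  have t01 : 0 <= (b - a) / (b - z) <= 1.
    by apply/andP; split; [rewrite divr_ge0 ?ltW|rewrite ler_pdivrMr// mul1r; lra].
  have := convex_le z b t01.
  have -> : (b - a) / (b - z) * z + (1 - (b - a) / (b - z)) * b = a.
    by field; rewrite gt_eqF.
  have e : (b - a) / (b - z) * L z + (1 - (b - a) / (b - z)) * L b =
     ((b - a) * L z + (a - z) * L b) / (b - z) by field; rewrite gt_eqF.
  rewrite {}e ler_pdivlMr// => H.
  rewrite -(ler_pM2r ba) mulrDl mulrAC divfK ?gt_eqF//; lra.
have za : 0 < z - a by lra.
have t01 : 0 <= (b - a) / (z - a) <= 1.
  by apply/andP; split; [rewrite divr_ge0 ?ltW|rewrite ler_pdivrMr// mul1r; lra].
have := convex_le z a t01.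
have -> : (b - a) / (z - a) * z + (1 - (b - a) / (z - a)) * a = b.
  by field; rewrite gt_eqF.
have e : (b - a) / (z - a) * L z + (1 - (b - a) / (z - a)) * L a =
   ((b - a) * L z + (z - b) * L a) / (z - a) by field; rewrite gt_eqF.
rewrite {}e ler_pdivlMr// => H.
rewrite -(ler_pM2r ba) mulrDl mulrAC divfK ?gt_eqF//; lra.
Qed.

(* Outside of [[a, b]] convexity puts the chord below [L]; inside, [L >= 0]
   suffices once [C] is large. *)
Lemma affine_minorant (a b : R) : a < b ->
  exists C, forall z, (L b - L a) / (b - a) * z - C <= L z.
Proof.
move=> ab; set k := _ / _.
exists (`|k| * (`|a| + `|b|) + `|k * a - L a|) => z.
have [za|az] := leP z a.
  have := chord_le ab (or_introl za); rewrite -/k.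
  have := ler_norm (k * a - L a).
  have : 0 <= `|k| * (`|a| + `|b|) by rewrite mulr_ge0 ?addr_ge0.
  lra.
have [bz|zb] := leP b z.
  have := chord_le ab (or_intror bz); rewrite -/k.
  have := ler_norm (k * a - L a).
  have : 0 <= `|k| * (`|a| + `|b|) by rewrite mulr_ge0 ?addr_ge0.
  lra.
have : k * z <= `|k| * (`|a| + `|b|).
  rewrite (le_trans (ler_norm _))// normrM ler_wpM2l//.
  have := ler_norm b; have := ler_norm (- a); rewrite normrN ler_norml => H1 H2.
  have := normr_ge0 a; have := normr_ge0 b.
  by move=> ? ?; apply/andP; split; lra.
by have := L_ge0 z; have := normr_ge0 (k * a - L a); lra.
Qed.

(** [Lam] is the supremum of the difference quotients. A secant whose slope nearly attains it yields
    a global minorant by [affine_minorant]. *)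
Lemma best_lipschitz : exists Lam : R,
  [/\ 0 <= Lam, forall a b, `|L a - L b| <= Lam * `|a - b|
    & forall e, 0 < e -> exists k C, Lam - e <= `|k| /\ forall z, k * z - C <= L z].
Proof.
pose S := [set `|L p.1 - L p.2| / `|p.1 - p.2| | p in [set: R * R]].
have [M [M0 ML]] : exists M, 0 <= M /\ forall a b, `|L a - L b| <= M * `|a - b|.
  (* [lipschitz] grants the bound for constants strictly above [M]. *)
  case: L_lipschitz => M [_ HM]; exists (`|M| + 1); split; first by rewrite addr_ge0.
  by move=> a b; apply: (HM (`|M| + 1) _ (a, b)); rewrite ?ltr_pwDr// ler_norm.
have Sub : ubound S M.
  move=> _ [[a b] _ <-] /=; have [->|ab] := eqVneq a b.
    by rewrite !subrr normr0 mul0r.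
  by rewrite ler_pdivrMr ?normr_gt0 ?subr_eq0.
have S0 : S 0 by exists (0, 0) => //=; rewrite !subrr normr0 mul0r.
have supS : has_sup S by split; [exists 0|exists M].
exists (sup S); split.
- by apply: ub_le_sup => //; exists M.
- move=> a b; have [->|ab] := eqVneq a b; first by rewrite !subrr normr0 mulr0.
  rewrite -ler_pdivrMr ?normr_gt0 ?subr_eq0//.
  by apply: ub_le_sup; [exists M|exists (a, b)].
- move=> e e0; have [_ [[a b] _ <-]/= He] := sup_adherent e0 supS.
  have [ab|ab] := eqVneq a b.
    (* A degenerate pair has quotient [0], so [Lam < e] and the zero function is a suitable
       minorant. *)
    exists 0, 0; split; last by move=> z; rewrite mul0r subr0.
    by move: He; rewrite ab !subrr normr0 mul0r => /ltW.
  wlog {ab} : a b He / a < b => [H|ab].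
    move: ab; rewrite neq_lt => /orP[/(H _ _ He)//|ba].
    by apply: (H b a) => //; rewrite (distrC (L b)) (distrC b).
  have [C HC] := affine_minorant ab.
  exists ((L b - L a) / (b - a)), C; split=> //.
  by rewrite normrM normfV (distrC (L b)) (distrC b) ltW.
Qed.

End ConvexSlopes.

(** [coupling] only equates set functions on measurable sets; this turns such an equality into one
    of integrals. *)
Lemma ge0_integral_marginal d1 d2 (X : measurableType d1) (Y : measurableType d2)
    (R : realType) (phi : X -> Y) (mu : {measure set X -> \bar R})
    (nu : {measure set Y -> \bar R}) (f : Y -> \bar R) :
  measurable_fun setT phi ->
  (forall A, measurable A -> pushforward mu phi A = nu A) ->
  (forall y, (0 <= f y)%E) -> measurable_fun setT f ->
  (\int[nu]_y f y = \int[mu]_x f (phi x))%E.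
Proof.
move=> mphi munu f0 mf.
rewrite -[RHS](ge0_integral_pushforward mphi mu measurableT)//.
by apply: eq_measure_integral => A mA _; exact/esym/munu.
Qed.

(** * The worst-case loss as a norm-regularized empirical loss *)

Section WorstCaseLoss.
Context {R : realType} {n N : nat}.
Variable L : R -> R.
Hypothesis N_gt0 : (0 < N)%N.
Variable xi : 'I_N -> 'cV[R]_n.
Hypothesis L_ge0 : forall z : R, 0 <= L z.
Hypothesis L_cont : continuous L.
Local Notation T := (borelRn R n).

Let N0 : (N%:R : R) != 0. Proof. by rewrite pnatr_eq0 -lt0n. Qed.

Lemma measurable_loss (x : 'cV[R]_n) :
  measurable_fun [set: T] (fun u : T => (L (dotp u x))%:E).
Proof.
apply/measurable_EFinP; apply: (measurableT_comp _ (measurable_dotp x)).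
exact: continuous_measurable_fun.
Qed.

(** [empirical] is a bare set function; integration calls for a genuine measure with the same
    values. *)
Lemma empirical_probability : exists P : probability T R,
  (forall A, P A = empirical xi A) /\
  (forall f : T -> R, (forall u, 0 <= f u) -> measurable_fun setT f ->
    (\int[P]_u (f u)%:E)%E = (N%:R^-1 * \sum_(i < N) f (xi i))%:E).
Proof.
have invN0 : 0 <= (N%:R^-1 : R) by rewrite invr_ge0.
pose w (i : 'I_N) := NngNum invN0.
have w1 : (\sum_(i < N) (w i)%:num = 1).
  by rewrite sumr_const card_ord -[LHS]mulr_natl divff.
have [P [PE PI]] := discrete_probability (fun i => xi i : T) w1.
exists P; split=> [A|f f0 mf].
  by rewrite PE /empirical ge0_sume_distrr.
rewrite PI//; last exact/measurable_EFinP.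
by rewrite mulr_sumr -sumEFin.
Qed.

Variable Lam : R.
Hypothesis Lam_ge0 : 0 <= Lam.
Hypothesis Lam_lip : forall a b, `|L a - L b| <= Lam * `|a - b|.

(** Integrate [L <u, x> <= L <v, x> + Lam |x| |u - v|] against a coupling. The infimum over
    couplings need not be attained, hence the slack [e]. *)
Lemma wc_loss_le rho x : (wc_loss L xi rho x <=
  (saa_loss L xi x + rho * Lam * enorm x)%:E)%E.
Proof.
have [P0 [P0E P0I]] := empirical_probability.
apply: ge_ereal_sup => _ [Q QW <-]; rewrite unlock.
apply/lee_addgt0Pr => e e0.
have K0 : 0 < Lam * enorm x + 1 by rewrite ltr_wpDl// mulr_ge0// enorm_ge0.
have : (wasserstein1 Q (empirical xi) < (rho + e / (Lam * enorm x + 1))%:E)%E.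
  by rewrite (le_lt_trans QW)// lte_fin ltrDl divr_gt0.
move=> /ereal_inf_lt[_ [pi cpi <-] cost].
rewrite (@ge0_integral_marginal _ _ _ _ _ fst pi Q)//; last 3 first.
- by move=> A mA; have [] := cpi A mA.
- by move=> u; rewrite lee_fin.
- exact: measurable_loss.
have sndE : (\int[pi]_w (L (dotp (w.2 : 'cV[R]_n) x))%:E)%E = (saa_loss L xi x)%:E.
  rewrite -(@ge0_integral_marginal _ _ _ _ _ snd pi P0
    (fun u : T => (L (dotp u x))%:E))//.
  - rewrite (P0I (fun u : T => L (dotp u x)))//.
    by apply/measurable_EFinP; exact: measurable_loss.
  - by move=> A mA; have [_ ->] := cpi A mA; exact/esym/P0E.
  - by move=> u; rewrite lee_fin.
  - exact: measurable_loss.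
have mfst : measurable_fun [set: T * T]
    (fun w : T * T => (L (dotp (w.1 : 'cV[R]_n) x))%:E).
  exact: (measurableT_comp (measurable_loss x)).
have msnd : measurable_fun [set: T * T]
    (fun w : T * T => (L (dotp (w.2 : 'cV[R]_n) x))%:E).
  exact: (measurableT_comp (measurable_loss x)).
have mcost : measurable_fun [set: T * T]
    (fun w : T * T => (enorm ((w.1 : 'cV[R]_n) - w.2))%:E).
  by apply/measurable_EFinP; exact: measurable_enormB.
apply: (@le_trans _ _ (\int[pi]_w ((L (dotp (w.2 : 'cV[R]_n) x))%:E +
    (Lam * enorm x)%:E * (enorm ((w.1 : 'cV[R]_n) - w.2))%:E))%E).
  apply: ge0_le_integral => //.
  - by move=> w _; rewrite lee_fin.
  - by apply: emeasurable_funD => //; exact: measurable_funeM.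
  - move=> w _; rewrite -EFinM -EFinD lee_fin addrC -lerBlDr.
    rewrite (le_trans (ler_norm _))// (le_trans (Lam_lip _ _))// -mulrA.
    rewrite ler_wpM2l// -dotpBl (le_trans (cauchy_schwarz_norm _ _))//.
    by rewrite mulrC.
rewrite ge0_integralD//=; last 3 first.
- by move=> w _; rewrite lee_fin.
- by move=> w _; rewrite -EFinM lee_fin !mulr_ge0 ?enorm_ge0.
- exact: measurable_funeM.
rewrite sndE ge0_integralZl//=; last 2 first.
- by move=> w _; rewrite lee_fin enorm_ge0.
- by rewrite lee_fin mulr_ge0 ?enorm_ge0.
rewrite -EFinD.
apply: (@le_trans _ _ ((saa_loss L xi x)%:E +
    (Lam * enorm x)%:E * (rho + e / (Lam * enorm x + 1))%:E)%E).
  rewrite leeD2l// lee_wpmul2l ?lee_fin ?mulr_ge0 ?enorm_ge0//; exact: ltW.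
rewrite -EFinM -EFinD lee_fin -addrA lerD2l mulrDr.
have : Lam * enorm x * (e / (Lam * enorm x + 1)) <= e.
  rewrite mulrCA ler_piMr ?(ltW e0)//.
  by rewrite ler_pdivrMr// mul1r lerDl.
lra.
Qed.

(** Each atom sends a fraction [eta] of its mass along [v], at total cost [eta |v|]. *)
Lemma wc_loss_perturb rho x (eta : R) (v : 'cV[R]_n) : 0 <= eta <= 1 ->
  eta * enorm v <= rho ->
  (((1 - eta) * saa_loss L xi x + eta * (N%:R^-1 * \sum_(i < N) L (dotp (xi i + v) x)))%:E
    <= wc_loss L xi rho x)%E.
Proof.
move=> /andP[eta0 eta1] etav.
have eta1' : 0 <= 1 - eta by rewrite subr_ge0.
have invN0 : 0 <= (N%:R^-1 : R) by rewrite invr_ge0.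
(* The Boolean marks the moved part of an atom; [p] pairs each point with its origin and so carries
   the coupling. *)
pose w (ib : 'I_N * bool) : {nonneg R} :=
  NngNum (mulr_ge0 invN0 (if ib.2 as b return 0 <= (if b then eta else 1 - eta)
    then eta0 else eta1')).
pose q (ib : 'I_N * bool) : T := if ib.2 then xi ib.1 + v else xi ib.1.
pose p (ib : 'I_N * bool) : T * T := (q ib, xi ib.1 : T).
have sum2 (F : 'I_N * bool -> R) :
    \sum_ib (w ib)%:num * F ib = (1 - eta) * (N%:R^-1 * \sum_(i < N) F (i, false)) +
      eta * (N%:R^-1 * \sum_(i < N) F (i, true)).
  transitivity (\sum_i \sum_b (w (i, b))%:num * F (i, b)).
    by rewrite pair_bigA; apply: eq_bigr => -[].
  rewrite !mulr_sumr -big_split/=; apply: eq_bigr => i _.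
  by rewrite big_bool /=; ring.
have sum2e (F : 'I_N * bool -> R) : (\sum_ib (w ib)%:num%:E * (F ib)%:E)%E =
    ((1 - eta) * (N%:R^-1 * \sum_(i < N) F (i, false)) +
      eta * (N%:R^-1 * \sum_(i < N) F (i, true)))%:E.
  by rewrite -sum2 -sumEFin.
have sum1 : N%:R^-1 * \sum_(i < N) 1 = 1 :> R.
  by rewrite sumr_const card_ord mulVf.
have w1 : \sum_ib (w ib)%:num = 1.
  under eq_bigr do rewrite -[(w _)%:num]mulr1.
  by rewrite (sum2 (fun=> 1)) sum1; ring.
have [Q [QE QI]] := discrete_probability q w1.
have [pi [piE piI]] := discrete_probability p w1.
apply: (@le_trans _ _ ('E_Q[fun u : T => L (dotp (u : 'cV[R]_n) x)])%E).
  rewrite expectation.unlock QI; [|by move=> u; rewrite lee_fin|exact: measurable_loss].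
  by rewrite (sum2e (fun ib => L (dotp (q ib : 'cV[R]_n) x))).
apply: ereal_sup_ubound; exists Q => //; rewrite /wball /=.
apply: (@le_trans _ _ (\int[pi]_w (enorm ((w.1 : 'cV[R]_n) - w.2))%:E)%E).
  apply: ereal_inf_lbound; exists pi => // A mA; split.
    by rewrite /pushforward piE QE.
  rewrite /pushforward piE /empirical.
  have -> : (\sum_(i < N) \d_(xi i : T) A)%E =
      (\sum_(i < N) (xi i \in A)%:R)%:E :> \bar R.
    by rewrite -sumEFin; apply: eq_bigr => i _; rewrite diracE.
  under eq_bigr do rewrite diracE.
  rewrite (sum2e (fun ib => ((p ib \in snd @^-1` A)%:R))) -EFinM; congr EFin.
  rewrite /p /=.
  have e b : \sum_(i < N) ((q (i, b), xi i : T) \in snd @^-1` A)%:R =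
      \sum_(i < N) (xi i \in A)%:R :> R.
    by apply: eq_bigr.
  by rewrite !e; ring.
rewrite piI; last 2 first.
- by move=> ?; rewrite lee_fin enorm_ge0.
- by apply/measurable_EFinP; exact: measurable_enormB.
rewrite (sum2e (fun ib => enorm ((q ib : 'cV[R]_n) - xi ib.1))) lee_fin /q/=.
have -> : \sum_(i < N) enorm (xi i - xi i) = 0.
  by rewrite big1// => i _; rewrite subrr enorm0.
have -> : \sum_(i < N) enorm (xi i + v - xi i) = N%:R * enorm v.
  under eq_bigr do rewrite addrC addKr.
  by rewrite sumr_const card_ord mulr_natl.
by rewrite mulKf// !mulr0 add0r.
Qed.

Hypothesis Lam_slope : forall e, 0 < e ->
  exists k C, Lam - e <= `|k| /\ forall z, k * z - C <= L z.

(** A fraction [eta], moved along [x] with the sign of [k] by at most [rho / eta], gains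
    [|k| rho |x|] on an affine minorant of slope [k]. Replacing [L] by the minorant on that fraction
    costs at most [eta M <= e / 2], and having [|k|] instead of [Lam] at most [e / 2]. *)
Lemma wc_loss_ge rho x : 0 <= rho ->
  ((saa_loss L xi x + rho * Lam * enorm x)%:E <= wc_loss L xi rho x)%E.
Proof.
move=> rho0; apply/lee_addgt0Pr => e e0.
pose K := rho * enorm x + 1.
have K0 : 0 < K by rewrite ltr_wpDl// mulr_ge0// enorm_ge0.
have [k [C [Lk kC]]] := Lam_slope (divr_gt0 e0 (mulr_gt0 (ltr0n R 2) K0)).
pose M := `|saa_loss L xi x - N%:R^-1 * \sum_(i < N) (k * dotp (xi i) x - C)| + 1.
have M0 : 0 < M by rewrite ltr_wpDl.
pose eta := Num.min 1 (e / 2 / M).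
have eta0 : 0 < eta by rewrite lt_min ltr01 !divr_gt0.
have eta1 : eta <= 1 by rewrite ge_min lexx.
have etaM : eta * M <= e / 2.
  by rewrite -ler_pdivlMr// ge_min lexx orbT.
pose v := (Num.sg k * rho / eta / enorm x) *: x.
have etav : eta * enorm v <= rho.
  rewrite enormZ.
  have [->|x0] := eqVneq x 0; first by rewrite enorm0 !mulr0.
  have xp := enorm_gt0 x0.
  rewrite !normrM !normfV (gtr0_norm eta0) (gtr0_norm xp) (ger0_norm rho0).
  have -> : eta * (`|Num.sg k| * rho / eta / enorm x * enorm x) = `|Num.sg k| * rho.
    by field; rewrite !gt_eqF.
  rewrite ler_piMl// normr_sg; by case: (k != 0).
have kv : eta * (k * dotp v x) = `|k| * (rho * enorm x).
  rewrite /v dotpZl -sqr_enorm.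
  have [->|x0] := eqVneq x 0; first by rewrite enorm0 expr0n/= !mulr0.
  have xp := enorm_gt0 x0.
  rewrite [`|k|]normrEsg; by field; rewrite !gt_eqF.
have eta01 : 0 <= eta <= 1 by rewrite ltW.
rewrite -leeBlDr//; apply: le_trans (wc_loss_perturb x eta01 etav).
rewrite -EFinB lee_fin.
set S := saa_loss L xi x.
have low : N%:R^-1 * \sum_(i < N) (k * dotp (xi i) x - C) + k * dotp v x <=
    N%:R^-1 * \sum_(i < N) L (dotp (xi i + v) x).
  have <- : N%:R^-1 * \sum_(i < N) (k * dotp v x) = k * dotp v x.
    by rewrite sumr_const card_ord -(mulr_natl (k * dotp v x)) mulKf.
  rewrite -mulrDr ler_wpM2l ?invr_ge0// -big_split ler_sum// => i _ /=.
  by have := kC (dotp (xi i + v) x); rewrite dotpDl; lra.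
have := ler_wpM2l (ltW eta0) low; rewrite mulrDr kv => {}low.
have slope : rho * Lam * enorm x <= `|k| * (rho * enorm x) + e / 2.
  have : (Lam - `|k|) * (rho * enorm x) <= e / (2 * K) * K.
    apply: (@le_trans _ _ (e / (2 * K) * (rho * enorm x))).
      by rewrite ler_wpM2r ?mulr_ge0 ?enorm_ge0//; lra.
    rewrite ler_wpM2l ?divr_ge0 ?mulr_ge0 ?(ltW e0) ?(ltW K0)//.
    by rewrite /K lerDl.
  have -> : e / (2 * K) * K = e / 2 by field; rewrite gt_eqF.
  lra.
have : eta * (S - N%:R^-1 * \sum_(i < N) (k * dotp (xi i) x - C)) <= eta * M.
  by rewrite ler_wpM2l ?(ltW eta0)// (le_trans (ler_norm _))// lerDl.
lra.
Qed.

Lemma wc_lossE rho x : 0 <= rho ->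
  wc_loss L xi rho x = (saa_loss L xi x + rho * Lam * enorm x)%:E.
Proof.
by move=> rho0; apply/eqP; rewrite eq_le wc_loss_le wc_loss_ge.
Qed.

End WorstCaseLoss.

(** * The multiplicative suboptimality *)

(** The difference quotient tends to [c] from the right by the expansion, and to [0] by
    derivability. *)
Lemma right_slope_eq0 (R : realType) (f : R -> R) (c q : R) :
  is_derive (0 : R) (1 : R) f 0 ->
  (\forall e \near (0 : R)^'+, f e = f 0 + e * c + e ^+ 2 * q) -> c = 0.
Proof.
move=> [df dE] fE.
have cv : (h^-1 *: ((f \o shift 0) (h *: 1) - f 0) @[h --> (0 : R)^'+] --> (0 : R)).
  by apply: cvg_dnbhs_at_right; rewrite -[X in _ --> X]dE; exact: df.
have cq : (c + h * q @[h --> (0 : R)^'+] --> c).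
  apply: cvg_at_right_filter; rewrite -[X in _ --> X]addr0 -[X in _ + X](mul0r q).
  by apply: cvgD; [exact: cvg_cst|apply: cvgM; [exact: cvg_id|exact: cvg_cst]].
apply: (cvg_unique _ _ cv) => //.
apply: cvg_trans cq; apply: near_eq_cvg; near=> e.
have e0 : 0 < e by near: e; exact: nbhs_right_gt.
rewrite /= /shift [e *: 1]mulr1 addr0 (near fE e)//.
by rewrite /GRing.scale/=; field; rewrite gt_eqF.
Unshelve. all: by end_near.
Qed.

(** * The empirical loss around its minimizer *)

Section SaaQuadratic.
Context {R : realType} {n N : nat}.
Variable L : R -> R.
Hypothesis N_gt0 : (0 < N)%N.
Variable xi : 'I_N -> 'cV[R]_n.
Hypothesis L_diff : forall z : R, derivable (L : R^o -> R^o) z 1.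
Variables (x0 : 'cV[R]_n) (b c : R).
Hypothesis x0_saa : saa_solution L xi x0.
Hypothesis x0_neq0 : x0 != 0.
Hypothesis L_quad : forall z : R, prediction_set xi (enorm x0) z ->
  L z = z ^+ 2 + b * z + c.
Let H := second_moment xi.

Lemma second_moment_qform x y :
  qform H x y = N%:R^-1 * \sum_(i < N) dotp (xi i) x * dotp (xi i) y.
Proof.
rewrite /qform /H /second_moment -scalemxAl dotpZr mulmx_suml; congr (_ * _).
rewrite dotpC dotp_suml; apply: eq_bigr => i _.
rewrite -mulmxA dotpC mulrC (dotpC _ x).
have -> : xi i *m ((xi i)^T *m y) = dotp (xi i) y *: xi i.
  apply/matrixP => j k; rewrite ord1 !mxE big_ord1 mulrC; congr (_ * _).
by rewrite dotpZr.
Qed.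

Lemma saa_loss_quad x : enorm x <= enorm x0 ->
  saa_loss L xi x = qform H x x + dotp (N%:R^-1 *: \sum_(i < N) b *: xi i) x + c.
Proof.
move=> xr; rewrite second_moment_qform dotpZl dotp_suml.
have -> : c = N%:R^-1 * \sum_(i < N) c.
  by rewrite sumr_const card_ord -(mulr_natl c) mulKf// pnatr_eq0 -lt0n.
rewrite -!mulrDr -!big_split/= /saa_loss; congr (_ * _); apply: eq_bigr => i _.
by rewrite L_quad ?dotpZl//; exists x, i; rewrite dotpC.
Qed.

Lemma derivable_saa_line (x d : 'cV[R]_n) (e : R) :
  derivable (fun e : R => saa_loss L xi (x + e *: d)) e 1.
Proof.
have -> : (fun e : R => saa_loss L xi (x + e *: d)) =
    N%:R^-1 \*: \sum_(i < N) (L \o (fun e => dotp (xi i) x + e * dotp (xi i) d)).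
  apply/funext => t; rewrite /saa_loss /= fct_sumE; congr (_ * _).
  by apply: eq_bigr => i _ /=; rewrite dotpDr dotpZr.
apply: derivableZ; apply: derivable_sum => i.
have gd : is_derive e 1 (fun e => dotp (xi i) x + e * dotp (xi i) d) (dotp (xi i) d).
  by apply: is_derive_eq; rewrite /GRing.scale/= mulr0 mulr1 !add0r mul1r.
have Ld := DeriveDef (@L_diff (dotp (xi i) x + e * dotp (xi i) d)) erefl.
by have [] := @is_derive1_comp _ L
    (fun e => dotp (xi i) x + e * dotp (xi i) d) e _ _ Ld gd.
Qed.

(* [x0] lies on the boundary of the ball where the loss is quadratic, so only
   inward directions can be expanded; differentiability makes the slope vanish
   along those, and they span the space. *)
Lemma saa_loss_center x : enorm x <= enorm x0 ->
  saa_loss L xi x = saa_loss L xi x0 + qform H (x - x0) (x - x0).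
Proof.
(* The gradient at [x0] of the quadratic expansion. *)
pose g := 2 *: (H *m x0) + N%:R^-1 *: \sum_(i < N) b *: xi i.
have H_sym u v : qform H u v = qform H v u.
  by rewrite !second_moment_qform; congr (_ * _); apply: eq_bigr => i _; rewrite mulrC.
have expand y : enorm y <= enorm x0 ->
    saa_loss L xi y = saa_loss L xi x0 + dotp g (y - x0) + qform H (y - x0) (y - x0).
  move=> yr; rewrite !saa_loss_quad//.
  rewrite /g !(qformBl, qformBr, dotpBr, dotpDl).
  rewrite !(dotpZl _ (H *m x0), dotpZl _ _ (H *m x0)).
  rewrite !(dotpC (H *m x0)) -!/(qform H _ _) (H_sym x0 y); ring.
have inward d : dotp d x0 < 0 -> dotp g d = 0.
  move=> d0; pose f (e : R) := saa_loss L xi (x0 + e *: d).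
  apply: (@right_slope_eq0 _ f _ (qform H d d)).
    have le11 : (-1 : R) <= 1 by lra.
    apply: (derive1_at_min le11) => [e _||e _].
    - exact: derivable_saa_line.
    - by rewrite in_itv/= ltr01 andbT oppr_lt0.
    - by rewrite /f scale0r addr0; exact: x0_saa.
  have d1 : 0 < dotp d d + 1 by rewrite ltr_wpDl// dotp_ge0.
  near=> e.
  have e0 : 0 < e by near: e; exact: nbhs_right_gt.
  rewrite /f scale0r addr0 expand; last first.
    (* Below this threshold [x0 + e d] stays in the ball. *)
    have : e <= - 2 * dotp d x0 / (dotp d d + 1).
      by near: e; apply: nbhs_right_le; apply: (divr_gt0 _ d1); rewrite mulNr oppr_gt0 pmulr_rlt0.
    rewrite ler_pdivlMr// => ed.
    rewrite enorm_leP ?enorm_ge0// sqr_enorm !dotpLR (dotpC x0 d); nra.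
  by rewrite [x0 + _]addrC addrK !qformLR dotpZr; ring.
have r0 : 0 < dotp x0 x0 by rewrite -sqr_enorm exprn_gt0// enorm_gt0.
(* The inward direction [- x0] gives [<g, x0> = 0]; then [g - x0] is inward too and gives
   [<g, g> = 0]. *)
have gx0 : dotp g x0 = 0.
  have := inward (- x0); rewrite dotpNl dotpNr oppr_lt0 => /(_ r0) /eqP.
  by rewrite oppr_eq0 => /eqP.
have : dotp g g = 0.
  have := inward (g - x0); rewrite dotpBl dotpBr gx0 sub0r oppr_lt0 subr0.
  exact.
rewrite -sqr_enorm => /eqP; rewrite sqrf_eq0 => /eqP/enorm_eq0 g0 xr.
by rewrite expand// g0 dotp0l addr0.
Unshelve. all: by end_near.
Qed.

End SaaQuadratic.

Section Eigenvalues.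
Context {R : realType} {n : nat}.

Lemma posdef_eigenvalue_gt0 (A : 'M[R]_n) a : posdef A -> eigenvalue A a -> 0 < a.
Proof.
move=> Apos /eigenvalueP[v vA v0].
have vT0 : v^T != 0 by apply: contra_neq v0 => /(congr1 trmx); rewrite trmxK trmx0.
have := Apos.2 _ vT0; rewrite trmxK vA -scalemxAl mxE => H.
rewrite -(pmulr_lgt0 _ (_ : 0 < dotp v^T v^T))//; first by rewrite /dotp trmxK.
by rewrite -sqr_enorm exprn_gt0// enorm_gt0.
Qed.

(** Kantorovich's inequality in the form that [shrinkage_gap] takes as hypothesis. *)
Lemma enorm_mulmx_le (A : 'M[R]_n) l u x : posdef A ->
    min_eigenvalue A l -> max_eigenvalue A u ->
  enorm (A *m x) * enorm x <= (u / l + 1) / (2 * Num.sqrt (u / l)) * qform A x x.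
Proof.
move=> Apos [lA lmin] [uA umax].
have l0 := posdef_eigenvalue_gt0 Apos lA.
have u0 := posdef_eigenvalue_gt0 Apos uA.
have Alu a : eigenvalue A a -> l <= a <= u by move=> aA; rewrite lmin// umax.
have Kan := kantorovich x Apos.1 Alu l0 (lmin _ uA).
rewrite [leRHS]mulrAC ler_pdivlMr ?mulr_gt0 ?sqrtr_gt0 ?divr_gt0//.
by rewrite mulrC.
Qed.

End Eigenvalues.

Section Ratio.
Context {R : realType}.
Local Open Scope ereal_scope.

(** An infinite denominator has inverse [0]; a finite one is at least [D > 0]. *)
Lemma ratio_le (a d : \bar R) (T D : R) : (0 < D)%R -> (0 <= T)%R ->
  0 <= a -> a <= (T * D)%:E -> D%:E <= d -> a / d <= T%:E.
Proof.
move=> D0 T0 a0 aTD; case: d => [d| |]//=.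
  rewrite lee_fin => Dd; have d0 : (0 < d)%R by exact: lt_le_trans Dd.
  rewrite inver gt_eqF// lee_pdivrMr// (le_trans aTD)// -EFinM lee_fin.
  by rewrite ler_wpM2l.
by move=> _; rewrite invey mule0.
Qed.

End Ratio.

(** * From real-valued bounds to extended-real suboptimalities *)

Section Assembly.
Context {R : realType} {n N : nat}.
Variables (xi : 'I_N -> 'cV[R]_n) (L : R -> R) (x0 xinf : 'cV[R]_n).
Variables (f : R -> 'cV[R]_n -> R) (Lam : R).
Hypothesis f_ge0 : forall rho x, 0 <= rho -> 0 <= f rho x.
Hypothesis wcE : forall rho x, 0 <= rho -> wc_loss L xi rho x = (f rho x)%:E.

(** Finiteness makes the subtractions in [additive_subopt] well behaved. *)
Lemma opt_value_fin rho : 0 <= rho -> exists2 v, opt_value L xi rho = v%:E &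
  forall x, v <= f rho x.
Proof.
move=> rho0.
have up x : (opt_value L xi rho <= (f rho x)%:E)%E.
  by rewrite -wcE//; apply: ereal_inf_lbound; exists x.
have low : (0 <= opt_value L xi rho)%E.
  by apply: le_ereal_inf_tmp => _ [x _ <-]; rewrite wcE// lee_fin f_ge0.
have fin : opt_value L xi rho \is a fin_num.
  rewrite ge0_fin_numE//; exact: le_lt_trans (up 0) (ltry _).
exists (fine (opt_value L xi rho)); first by rewrite fineK.
by move=> x; rewrite -lee_fin fineK.
Qed.

Lemma shrinkage_subopt_ge0 :
  (0 <= additive_subopt L xi (shrinkage_value L xi x0 xinf))%E.
Proof.
apply: le_ereal_sup_tmp.
exists (shrinkage_value L xi x0 xinf 0 - opt_value L xi 0)%E; first by exists 0 => /=.
have [v vE vle] := opt_value_fin (lexx 0).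
rewrite vE sube_ge0//; apply: le_ereal_inf_tmp => _ [t _ <-].
by rewrite wcE// lee_fin.
Qed.

Lemma shrinkage_subopt_le (K : R) :
  (forall rho x, 0 <= rho -> exists2 t, 0 <= t <= 1 &
     f rho ((1 - t) *: x0 + t *: xinf) <= f rho x + K) ->
  (additive_subopt L xi (shrinkage_value L xi x0 xinf) <= K%:E)%E.
Proof.
move=> fK; apply: ge_ereal_sup => _ [rho /= rho0 <-].
have [v vE vle] := opt_value_fin rho0.
rewrite {1}vE leeBlDr// -leeBlDl//.
have -> : v%:E = opt_value L xi rho by [].
apply: le_ereal_inf_tmp => _ [x _ <-]; rewrite wcE// leeBlDl// -EFinD.
have [t t01 ft] := fK _ x rho0.
apply: (@le_trans _ _ (f rho ((1 - t) *: x0 + t *: xinf))%:E); last first.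
  by rewrite lee_fin [K + _]addrC.
by rewrite -wcE//; apply: ereal_inf_lbound; exists t => //=; rewrite in_itv.
Qed.

(** A single radius is enough, and [y] bounds the optimal value there from above. *)
Lemma saa_ro_subopt_ge (K rho : R) (y : 'cV[R]_n) : 0 <= rho ->
  K + f rho y <= f rho x0 -> K + f rho y <= f rho xinf ->
  (K%:E <= additive_subopt L xi (saa_ro_value L xi x0 xinf))%E.
Proof.
move=> rho0 K0 Kinf; apply: le_ereal_sup_tmp.
exists (saa_ro_value L xi x0 xinf rho - opt_value L xi rho)%E; first by exists rho.
have [v vE vle] := opt_value_fin rho0.
rewrite vE leeBrDr// -EFinD /saa_ro_value !wcE// le_min !lee_fin.
by have vy := vle y; apply/andP; split; lra.
Qed.

End Assembly.

(** Along a nonzero [xinf] the minorant is unbounded above, whereas the robust loss at [0] is [L 0];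
    the scalar [s] makes the minorant equal to [L 0 + 1]. *)
Lemma robust_solution_eq0 (R : realType) (n : nat) (L : R -> R) (xinf : 'cV[R]_n) k C :
  k != 0 -> (forall z, k * z - C <= L z) -> robust_solution L xinf -> xinf = 0.
Proof.
move=> k0 kC /(_ 0) rob; apply/eqP; apply: contraT => xinf0.
have xp := enorm_gt0 xinf0.
pose s := (L 0 + C + 1) / (k * enorm xinf ^+ 2).
have : ((L (dotp (s *: xinf) xinf))%:E <= (L 0)%:E)%E.
  apply: (@le_trans _ _ (robust_loss L xinf)).
    by apply: ereal_sup_ubound; exists (s *: xinf).
  by apply: (le_trans rob); apply: ge_ereal_sup => _ [u _ <-]; rewrite dotp0r.
rewrite lee_fin; have := kC (dotp (s *: xinf) xinf).
have -> : k * dotp (s *: xinf) xinf = L 0 + C + 1.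
  rewrite dotpZl -sqr_enorm /s; field.
  by rewrite k0 gt_eqF.
lra.
Qed.

Unset Implicit Arguments.

Theorem theorem3 (R : realType) (n N : nat) (n_gt0 : (0 < n)%N)
    (N_gt0 : (0 < N)%N) (xi : 'I_N -> 'cV[R]_n) (L : R -> R)
    (L_ge0 : forall z : R, 0 <= L z)
    (L_convex : @convex_function R R^o setT L)
    (L_lipschitz : lipschitz (L : R^o -> R^o))
    (L_diff : forall z : R, derivable (L : R^o -> R^o) z 1)
    (x0 xinf : 'cV[R]_n)
    (x0_saa : saa_solution L xi x0)
    (xinf_robust : robust_solution L xinf)
    (b c : R)
    (L_quad : forall z : R, prediction_set xi (enorm x0) z ->
       L z = z ^+ 2 + b * z + c)
    (H_posdef : posdef (second_moment xi))
    (lmin lmax : R)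
    (lminP : min_eigenvalue (second_moment xi) lmin)
    (lmaxP : max_eigenvalue (second_moment xi) lmax) :
  (multiplicative_subopt L xi x0 xinf <= (kappa_bound (lmax / lmin))%:E)%E /\
  (forall kappa : R, 1 <= kappa -> kappa_bound kappa < 1).
Proof.
split; last first.
  by move=> k k1; rewrite kappa_bound_gap//; exact/gap_ratio_lt1/kappa_mean_ge1.
have l0 := posdef_eigenvalue_gt0 H_posdef lminP.1.
have k1 : 1 <= lmax / lmin by rewrite ler_pdivlMr// mul1r lmaxP.2// lminP.1.
rewrite kappa_bound_gap//.
pose t := (lmax / lmin + 1) / (2 * Num.sqrt (lmax / lmin)); rewrite -/t.
have t1 : 1 <= t := kappa_mean_ge1 k1.
have L_cont : continuous L.
  by move=> z; apply/differentiable_continuous/derivable1_diffP/L_diff.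
have [Lam [Lam0 lip slope]] := best_lipschitz L_ge0 L_convex L_lipschitz.
pose f rho x := saa_loss L xi x + rho * Lam * enorm x.
have wcE rho x : 0 <= rho -> wc_loss L xi rho x = (f rho x)%:E.
  exact: wc_lossE.
have f_ge0 rho x : 0 <= rho -> 0 <= f rho x.
  move=> rho0; rewrite addr_ge0 ?mulr_ge0 ?invr_ge0 ?enorm_ge0 ?sumr_ge0//.
have shrink0 := shrinkage_subopt_ge0 x0 xinf f_ge0 wcE.
(* If [x0] is optimal at every radius, the numerator is [0], and so is the ratio, whatever the
   denominator. *)
have trivial_case : (forall rho x, 0 <= rho -> f rho x0 <= f rho x) ->
    (multiplicative_subopt L xi x0 xinf <= (gap_ratio t)%:E)%E.
  move=> fx0; rewrite /multiplicative_subopt.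
  have -> : additive_subopt L xi (shrinkage_value L xi x0 xinf) = 0%E.
    apply/eqP; rewrite eq_le shrink0 andbT.
    apply: (shrinkage_subopt_le f_ge0 wcE) => rho x rho0.
    by exists 0; rewrite ?lexx ?ler01// subr0 scale1r scale0r !addr0 fx0.
  by rewrite mul0e lee_fin gap_ratio_ge0.
(* The penalty vanishes at [x0 = 0], and everywhere when [Lam = 0]; in both cases [x0] is optimal at
   every radius. *)
have [x00|x00] := eqVneq x0 0.
  apply: trivial_case => rho x rho0.
  by rewrite lerD// x00 enorm0 mulr0 !mulr_ge0 ?enorm_ge0.
have [Lam00|Lam_neq0] := eqVneq Lam 0.
  by apply: trivial_case => rho x rho0; rewrite /f Lam00 mulr0 !mul0r !addr0.
have Lam_gt0 : 0 < Lam by rewrite lt0r Lam_neq0.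
have xinf0 : xinf = 0.
  have Lam2 : 0 < Lam / 2 by rewrite divr_gt0.
  have [k [C [kLam kC]]] := slope _ Lam2.
  apply: (robust_solution_eq0 _ kC xinf_robust).
  by rewrite -normr_gt0; lra.
rewrite {}xinf0 in shrink0 *.
pose h := qform (second_moment xi) x0 x0; pose r := enorm x0.
have h_gt0 : 0 < h by exact: qform_gt0.
have r_gt0 : 0 < r by exact: enorm_gt0.
have tH : enorm (second_moment xi *m x0) * enorm x0 <= t * qform (second_moment xi) x0 x0.
  exact: enorm_mulmx_le.
have [y [yr yh gap]] := shrinkage_gap H_posdef x00 t1 tH.
have fE rho x : enorm x <= enorm x0 -> f rho x = saa_loss L xi x0 +
    (qform (second_moment xi) (x - x0) (x - x0) + rho * Lam * enorm x).
  move=> xr; rewrite /f (saa_loss_center N_gt0 L_diff x0_saa x00 L_quad xr).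
  by rewrite addrA.
have shrink_norm s : 0 <= s <= 1 -> enorm ((1 - s) *: x0) <= enorm x0.
  move=> /andP[s0 s1]; rewrite enormZ ger0_norm ?subr_ge0// ler_piMl ?enorm_ge0//.
  by rewrite lerBlDr lerDl.
pose D := h - (qform (second_moment xi) (y - x0) (y - x0) + h / r * enorm y).
have D_gt0 : 0 < D by rewrite subr_gt0.
apply: (ratio_le D_gt0 (gap_ratio_ge0 t1) shrink0).
  apply: (shrinkage_subopt_le f_ge0 wcE) => rho x rho0.
  have [xr|rx] := leP (enorm x) (enorm x0); last first.
    exists 0; first by rewrite lexx ler01.
    rewrite subr0 scale1r scaler0 addr0 -[leLHS]addr0 lerD//.
      by rewrite lerD// ler_wpM2l ?mulr_ge0// ltW.
    by rewrite mulr_ge0 ?gap_ratio_ge0// ltW.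
  have rhoL : 0 <= rho * Lam by rewrite mulr_ge0.
  have [s s01 sgap] := gap _ x rhoL; exists s => //.
  rewrite scaler0 addr0 !fE ?shrink_norm// -[leRHS]addrA lerD2l -lerBlDl.
  exact: sgap.
(* The radius of [tau = 1/2], at which both endpoints exceed [saa_loss L xi x0] by exactly [h]. *)
have rho1 : 0 <= h / r / Lam by rewrite !divr_ge0// ltW.
have rhoE : h / r / Lam * Lam = h / r by rewrite divfK.
apply: (saa_ro_subopt_ge f_ge0 wcE (y := y) rho1).
  have q0 : qform (second_moment xi) 0 0 = 0 by rewrite /qform dotp0l.
  rewrite !fE// rhoE subrr q0 add0r -/r divfK ?gt_eqF//.
  by rewrite /D; lra.
rewrite !fE ?enorm0 ?enorm_ge0// rhoE sub0r qformNN mulr0 addr0 -/h /D; lra.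
Qed.
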